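(* Let $X=\{\{X_{k,n},\ 1\le k\le k(n)\},\ n\ge1\}$ be an array of random variables defined on the same probability space, with $k(n)\to+\infty$, such that for each $n$ the row $\{X_{k,n},1\le k\le k(n)\}$ is associated. Let $(m(n),\ell(n),r(n))_{n\ge1}$ be sequences of non-negative integers with $k(n)=m(n)\ell(n)+r(n)$, $1\le m(n)\to+\infty$, $0\le r(n)<\ell(n)$ and $\ell(n)/m(n)\to0$. Suppose that: (1) for all $1\le k\le k(n)$, $X_{k,n}$ has the Bernoulli law $\mathcal B(p_{k,n})$ with $0<p_{k,n}<1$; (2) as $n\to+\infty$: (a) $\overline p_n:=\sup_{1\le k\le k(n)}p_{k,n}\to0$; (b) $\sum_{k=1}^{k(n)}p_{k,n}\to\lambda>0$; (c) $k(n)\,\overline p_n^2\to0$; (d) $k(n)^2\sup_{1\le r\ne s\le k(n)}\mathrm{Cov}(X_{r,n},X_{s,n})\to0$; (3) as $n\to+\infty$, $\sum_{h=1}^{r(n)}p_{m(n)\ell(n)+h,n}\to0$; (4) as $n\to+\infty$: (a) $m(n)\sup_{1\le j\le m(n)}\sum_{1\le r\ne s\le\ell(n)}\mathrm{Cov}\left(X_{(j-1)\ell(n)+r,n},X_{(j-1)\ell(n)+s,n}\right)\to0$; (b) $\sum_{1\le r\ne s\le r(n)}\mathrm{Cov}\left(X_{m(n)\ell(n)+r,n},X_{m(n)\ell(n)+s,n}\right)\to0$. Then $S_n[X]=\sum_{k=1}^{k(n)}X_{k,n}$ converges weakly to the Poisson law $\mathcal P(\lambda)$.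
   Context: Random variables $Z_1,\dots,Z_n$ are associated if for any coordinate-wise non-decreasing functions $h,g:\mathbb R^n\to\mathbb R$ one has $\mathrm{Cov}(h(Z_1,\dots,Z_n),g(Z_1,\dots,Z_n))\ge0$ (whenever the covariance exists). $\mathcal B(p)$ is the law with $\mathbb P(X=1)=p=1-\mathbb P(X=0)$. *)

(* Defs.v *)
From HB Require Import structures.
From mathcomp Require Import all_boot all_order all_algebra.
From mathcomp Require Import all_classical all_reals all_analysis.
From mathcomp Require Import measurable_realfun.

Set Implicit Arguments.
Unset Strict Implicit.
Unset Printing Implicit Defensive.

Import Order.TTheory GRing.Theory Num.Theory.
Import numFieldNormedType.Exports.

Local Open Scope classical_set_scope.
Local Open Scope ring_scope.

Definition coord_nondecreasing (R : realType) (n : nat)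
    (h : ('I_n -> R) -> R) : Prop :=
  forall x y : 'I_n -> R, (forall i, x i <= y i) -> h x <= h y.

(* [Lfun P 1] contains measurability, so the three membership conditions say
   that h(Z), g(Z) are random variables whose covariance exists; h and g
   themselves are not assumed to be Borel. *)
Definition associated d (T : measurableType d) (R : realType)
    (P : probability T R) (n : nat) (Z : 'I_n -> {RV P >-> R}) : Prop :=
  forall h g : ('I_n -> R) -> R,
    coord_nondecreasing h -> coord_nondecreasing g ->
    let hZ : T -> R := fun t => h (fun i => Z i t) in
    let gZ : T -> R := fun t => g (fun i => Z i t) in
    hZ \in Lfun P 1 -> gZ \in Lfun P 1 -> (hZ * gZ)%R \in Lfun P 1 ->
    (0 <= covariance P hZ gZ)%E.
Arguments associated {d T R} P {n} Z.

(* [bernoulli_prob] lives on [bool]; here the law is that of a real variable. *)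
Definition has_bernoulli_law d (T : measurableType d) (R : realType)
    (P : probability T R) (X : {RV P >-> R}) (p : R) : Prop :=
  distribution P X [set 1] = p%:E /\ distribution P X [set 0] = (1 - p)%:E.
Arguments has_bernoulli_law {d T R} P X p.

Definition natr_fun (R : realType) (n : nat) : R := n%:R.

Lemma measurable_natr_fun (R : realType) :
  measurable_fun [set: nat] (@natr_fun R).
Proof. by []. Qed.

HB.instance Definition _ (R : realType) :=
  isMeasurableFun.Build _ _ nat R (@natr_fun R) (@measurable_natr_fun R).

(* [poisson_prob rate] is a measure on [nat], transported here to the reals;
   its second argument is ignored by the library definition. *)
Definition poisson_law (R : realType) (rate : R) :
    probability R R :=
  distribution (poisson_prob rate 0) (@natr_fun R).

Definition weakly_converges (R : realType)
    (mu : nat -> probability R R)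
    (nu : probability R R) : Prop :=
  forall f : R -> R, continuous f -> bounded_fun f ->
    (\int[mu n]_x (f x)%:E)%E @[n --> \oo] --> (\int[nu]_x (f x)%:E)%E.

(* Main.v *)
From HB Require Import structures.
Require Import Defs.
From mathcomp Require Import all_boot all_order all_algebra.
From mathcomp Require Import all_classical all_reals all_analysis.
From mathcomp Require Import measurable_realfun ring lra.

Set Implicit Arguments.
Unset Strict Implicit.
Unset Printing Implicit Defensive.

Import Order.TTheory GRing.Theory Num.Theory.
Import numFieldNormedType.Exports.

Local Open Scope classical_set_scope.
Local Open Scope ring_scope.

(** The Stein-Chen method, with indicators of points as the only test functions.
    Let N be the number of the n-th row's variables equal to 1, with means p_i
    and N_i the same count without the i-th variable Y_i.  Since
      (j + 1) P(N = j + 1) = sum_i E[Y_i; N_i = j],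
    one may replace each summand by p_i P(N = j).  Passing from N_i to N costs at
    most p_i ^ 2.  Decoupling Y_i from the event N_i = j costs a covariance, and
    association bounds it by Cov(Y_i, N_i): the function of an integer that adds
    or subtracts the indicator of a point from the identity is nondecreasing
    ([cov_hit_point_le]).  Hence ([stein_chen_point])
      |E N * P(N = j) - (j + 1) P(N = j + 1)|
        <= sum_i p_i ^ 2 + sum_(i <> s) Cov(Y_i, Y_s).
    The right-hand side is at most k pbar ^ 2 + k ^ 2 sup Cov, which tends to 0,
    while E N tends to lambda.  So in the limit the masses of N satisfy
    lambda q_j = (j + 1) q_(j + 1), whose only normalized solution is the
    Poisson mass function; Markov's inequality, from the bounded means, ensures
    that no mass is lost ([mass_cvg]).

    Convergence of the point masses of laws on the naturals to those of a
    probability gives convergence of the integrals of bounded functions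
    ([points_cvg_weakly]), which is the weak convergence wanted, because the sum
    of the row is almost surely N ([integral_sum_law]).

    The combinatorial part takes place on the finite cube of binary vectors,
    with expectations written as finite weighted sums; [Rintegral_ones] and
    [covariance_ones] carry them to the probability space. *)

(** * Counts of associated binary variables *)

Section binary_vectors.
Context {R : realFieldType} {n : nat}.
Local Notation cube := {ffun 'I_n -> bool}.
Implicit Types (w h g : cube -> R) (e : cube) (i : 'I_n).

Definition mean w h : R := \sum_e w e * h e.

Definition cov w h g : R := mean w (fun e => h e * g e) - mean w h * mean w g.

Definition hit i e : R := (e i)%:R.

Definition hits e : nat := \sum_i e i.

Definition hits_off i e : nat := \sum_(s | s != i) e s.

Definition cube_nondecreasing h :=
  forall e e', (forall i, (e i <= e' i)%N) -> h e <= h e'.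

Definition cube_associated w := forall h g,
  cube_nondecreasing h -> cube_nondecreasing g -> 0 <= cov w h g.

Lemma eq_mean w h g : h =1 g -> mean w h = mean w g.
Proof. by move=> hg; apply: eq_bigr => e _; rewrite hg. Qed.

Lemma meanD w h g : mean w (fun e => h e + g e) = mean w h + mean w g.
Proof. by rewrite -big_split; apply: eq_bigr => e _; rewrite mulrDr. Qed.

Lemma meanB w h g : mean w (fun e => h e - g e) = mean w h - mean w g.
Proof. by rewrite -sumrB; apply: eq_bigr => e _; rewrite mulrBr. Qed.

Lemma mean_sum (I : Type) (r : seq I) (A : pred I) w (h : I -> cube -> R) :
  mean w (fun e => \sum_(i <- r | A i) h i e) = \sum_(i <- r | A i) mean w (h i).
Proof. by rewrite exchange_big; apply: eq_bigr => e _; rewrite mulr_sumr. Qed.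

Lemma le_mean w h g : (forall e, 0 <= w e) -> (forall e, h e <= g e) ->
  mean w h <= mean w g.
Proof. by move=> w0 hg; apply: ler_sum => e _; rewrite ler_wpM2l. Qed.

Lemma mean_ge0 w h : (forall e, 0 <= w e) -> (forall e, 0 <= h e) ->
  0 <= mean w h.
Proof. by move=> w0 h0; apply: sumr_ge0 => e _; rewrite mulr_ge0. Qed.

Lemma ler_norm_mean w h : (forall e, 0 <= w e) ->
  `|mean w h| <= mean w (fun e => `|h e|).
Proof.
move=> w0; apply: (le_trans (ler_norm_sum _ _ _)).
by apply: ler_sum => e _; rewrite normrM (ger0_norm (w0 e)).
Qed.

Lemma covDr w h g g' :
  cov w h (fun e => g e + g' e) = cov w h g + cov w h g'.
Proof.
rewrite /cov meanD (eq_mean w (g := fun e => h e * g e + h e * g' e)) ?meanD.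
  ring.
by move=> e; rewrite mulrDr.
Qed.

Lemma covBr w h g g' :
  cov w h (fun e => g e - g' e) = cov w h g - cov w h g'.
Proof.
rewrite /cov meanB (eq_mean w (g := fun e => h e * g e - h e * g' e)) ?meanB.
  ring.
by move=> e; rewrite mulrBr.
Qed.

Lemma cov_sumr (I : Type) (r : seq I) (A : pred I) w h (g : I -> cube -> R) :
  cov w h (fun e => \sum_(i <- r | A i) g i e) =
  \sum_(i <- r | A i) cov w h (g i).
Proof.
rewrite /cov sumrB -mulr_sumr -!mean_sum; congr (_ - _).
by apply: eq_mean => e; rewrite mulr_sumr.
Qed.

Lemma hit_nondecreasing i : cube_nondecreasing (hit i).
Proof. by move=> e e' /(_ i) ee'; rewrite ler_nat. Qed.

Lemma natr_hits e : (hits e)%:R = \sum_i hit i e.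
Proof. by rewrite natr_sum. Qed.

Lemma hitsE i e : hits e = (e i + hits_off i e)%N.
Proof. by rewrite /hits (bigD1 i). Qed.

Lemma hits_off_nondecreasing i e e' :
  (forall i, (e i <= e' i)%N) -> (hits_off i e <= hits_off i e')%N.
Proof. by move=> ee'; apply: leq_sum => s _; exact: ee'. Qed.

(** Among the integers the indicator of a point has slope at most one, so
    adding or subtracting it does not spoil the monotonicity of the count;
    association then applies to both combinations. *)
Lemma cov_hit_point_le w i (j : nat) : cube_associated w ->
  `|cov w (hit i) (fun e => (hits_off i e == j)%:R)| <=
  \sum_(s | s != i) cov w (hit i) (hit s).
Proof.
move=> assoc_w; rewrite -cov_sumr ler_norml.
have natE e : \sum_(s | s != i) hit s e = (hits_off i e)%:R.
  by rewrite natr_sum.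
have step (e e' : cube) (ee' : forall i, (e i <= e' i)%N) :
    (hits_off i e = hits_off i e') \/ (hits_off i e)%:R + 1 <= (hits_off i e')%:R :> R.
  have := hits_off_nondecreasing i ee'; rewrite leq_eqVlt => /orP[/eqP|lt].
    by left.
  by right; rewrite natr1 ler_nat.
have b01 (b : bool) : (0 <= b%:R :> R) && (b%:R <= 1 :> R).
  by case: b; rewrite lexx ler01.
apply/andP; split.
- rewrite -subr_ge0 opprK -covDr; apply: assoc_w => [|e e' ee'].
    exact: hit_nondecreasing.
  rewrite !natE; case: (step _ _ ee') => [->//|].
  have := b01 (hits_off i e == j); have := b01 (hits_off i e' == j).
  lra.
- rewrite -subr_ge0 -covBr; apply: assoc_w => [|e e' ee'].
    exact: hit_nondecreasing.
  rewrite !natE; case: (step _ _ ee') => [->//|].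
  have := b01 (hits_off i e == j); have := b01 (hits_off i e' == j).
  lra.
Qed.

(** The Stein equation of the Poisson law, tested on the indicator of j + 1.
    Size-biasing gives (j + 1) P(N = j + 1) as the sum over i of
    E[Y_i; N_i = j], where N_i omits Y_i.  In each term, replacing N by N_i
    costs at most p_i P(Y_i = 1), and decoupling Y_i from N_i costs a
    covariance. *)
Lemma stein_chen_point w (j : nat) :
    (forall e, 0 <= w e) -> cube_associated w ->
  `|(\sum_i mean w (hit i)) * mean w (fun e => (hits e == j)%:R) -
    j.+1%:R * mean w (fun e => (hits e == j.+1)%:R)| <=
  \sum_i mean w (hit i) ^+ 2 +
  \sum_i \sum_(s | s != i) cov w (hit i) (hit s).
Proof.
move=> w0 assoc_w.
have -> : j.+1%:R * mean w (fun e => (hits e == j.+1)%:R) =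
    \sum_i mean w (fun e => hit i e * (hits_off i e == j)%:R).
  rewrite -mean_sum /mean mulr_sumr; apply: eq_bigr => e _.
  rewrite mulrCA; congr (_ * _).
  transitivity (\sum_i hit i e * (hits e == j.+1)%:R).
    rewrite -mulr_suml -natr_hits.
    by case: eqP => [->|]; rewrite ?mulr0.
  apply: eq_bigr => i _; rewrite (hitsE i) /hit.
  by case: (e i); rewrite ?mul0r ?mul1r ?add1n ?eqSS.
rewrite mulr_suml -sumrB -big_split /=.
apply: (le_trans (ler_norm_sum _ _ _)); apply: ler_sum => i _.
set a := mean w (hit i); set b := mean w _; set c := mean w _.
pose b' := mean w (fun e => (hits_off i e == j)%:R).
(* The first summand compares N with N_i, the second is minus the covariance. *)
have -> : a * b - c = a * (b - b') - (c - a * b') by ring.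
apply: (le_trans (ler_normB _ _)); apply: lerD; last exact: cov_hit_point_le.
have a0 : 0 <= a by apply: mean_ge0 => // e; rewrite ler0n.
rewrite normrM (ger0_norm a0) expr2 ler_wpM2l// -meanB.
apply: (le_trans (ler_norm_mean _ w0)); apply: le_mean => // e.
rewrite (hitsE i) /hit; case: (e i) => /=; last by rewrite add0n subrr normr0.
by rewrite ler_norml; do 2!case: eqP => _ /=; lra.
Qed.

Lemma sum_point_indicators e J :
  \sum_(j < J) ((hits e == j)%:R : R) = (hits e < J)%N%:R.
Proof.
case: ltnP => [NJ|JN].
  rewrite (bigD1 (Ordinal NJ))//= eqxx big1 ?addr0// => j jN.
  by case: eqP => // Nj; case/eqP: jN; apply: val_inj.
by rewrite big1// => j _; rewrite gtn_eqF// (leq_trans (ltn_ord j)).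
Qed.

Lemma mean_point_ge0 w (j : nat) : (forall e, 0 <= w e) ->
  0 <= mean w (fun e => (hits e == j)%:R).
Proof. by move=> w0; apply: mean_ge0 => // e; rewrite ler0n. Qed.

Lemma mean_points_le1 w J : (forall e, 0 <= w e) -> \sum_e w e = 1 ->
  \sum_(j < J) mean w (fun e => (hits e == j)%:R) <= 1.
Proof.
move=> w0 w1.
rewrite [leRHS](_ : _ = mean w (fun=> 1)); last first.
  by rewrite /mean -mulr_suml w1 mulr1.
rewrite -mean_sum; apply: le_mean => // e; rewrite sum_point_indicators.
by case: ltnP => _; rewrite ?lexx ?ler01.
Qed.

(** Markov's inequality for the count. *)
Lemma mean_hits_tail w J : (forall e, 0 <= w e) -> \sum_e w e = 1 ->
  1 - \sum_(j < J.+1) mean w (fun e => (hits e == j)%:R) <=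
  (\sum_i mean w (hit i)) / J.+1%:R.
Proof.
move=> w0 w1.
have {1}-> : 1 = mean w (fun=> 1) by rewrite /mean -mulr_suml w1 mulr1.
rewrite -!mean_sum -meanB ler_pdivlMr ?ltr0n// mulrC /mean mulr_sumr.
apply: ler_sum => e _; rewrite mulrCA ler_wpM2l// -natr_hits.
rewrite sum_point_indicators; case: ltnP => JN; first by rewrite subrr mulr0.
by rewrite subr0 mulr1 ler_nat.
Qed.

End binary_vectors.

(** * The recursion characterizing the Poisson law *)

Lemma eq_cvg_to (R : realType) (f g : R ^nat) (l l' : R) :
  f @ \oo --> l -> l = l' -> f =1 g -> g @ \oo --> l'.
Proof. by move=> fl <- /funext <-. Qed.

Section poisson_limit.
Context {R : realType}.
Variables (lam : R) (a : R ^nat) (q : nat -> R ^nat).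
Hypothesis lam_gt0 : 0 < lam.
Hypothesis q_ge0 : forall n j, 0 <= q n j.
Hypothesis q_le1 : forall n J, \sum_(j < J) q n j <= 1.
Hypothesis q_tail : forall n J, 1 - \sum_(j < J.+1) q n j <= a n / J.+1%:R.
Hypothesis a_cvg : a @ \oo --> lam.
Hypothesis q_stein : forall j,
  a n * q n j - j.+1%:R * q n j.+1 @[n --> \oo] --> (0 : R).

Lemma mass_le1 n j : q n j <= 1.
Proof.
apply: (le_trans _ (q_le1 n j.+1)).
by rewrite big_ord_recr/= lerDr sumr_ge0.
Qed.

(** The Stein recursion determines each mass from the previous one, hence all
    of them from the mass at 0, up to errors that vanish in the limit. *)
Lemma mass_ratio_cvg j : q n j - exp_coeff lam j * q n 0%N @[n --> \oo] --> (0 : R).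
Proof.
elim: j => [|j IH].
  apply: (eq_cvg_to (cvg_cst 0)) => // n.
  by rewrite /exp_coeff/= expr0 fact0 invr1 !mul1r subrr.
have aq0 : (a n - lam) * q n j @[n --> \oo] --> (0 : R).
  apply: norm_cvg0.
  have : `|a n - lam| @[n --> \oo] --> (0 : R).
    rewrite -(normr0 R) -(subrr lam); apply: cvg_norm; apply: cvgB => //.
    exact: cvg_cst.
  apply: (@squeeze_cvgr _ _ _ _ (fun=> 0)); last exact: cvg_cst.
  apply: nearW => n; rewrite normr_ge0 normrM (ger0_norm (q_ge0 _ _)).
  by rewrite ler_piMr// mass_le1.
apply: (eq_cvg_to (cvgMl_tmp (a := j.+1%:R^-1)
  (cvgD (cvgB aq0 (q_stein j)) (cvgMl_tmp (a := lam) IH)))).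
  by rewrite subr0 mulr0 addr0 mulr0.
move=> n; rewrite /= !fctE /exp_coeff/= factS natrM exprS.
by field; rewrite pnatr_eq0 -lt0n fact_gt0 nat1r pnatr_eq0.
Qed.

(** The masses sum to 1 up to the Markov tail, uniformly in n, so the mass at 0
    must tend to the normalizing constant of lam ^ j / j!: the tail bound is
    what prevents mass from escaping to infinity. *)
Lemma mass0_cvg : q n 0%N @[n --> \oo] --> expR (- lam).
Proof.
suff h : q n 0%N * expR lam @[n --> \oo] --> (1 : R).
  apply: (eq_cvg_to (cvgMl_tmp (a := expR (- lam)) h)); first by rewrite mulr1.
  by move=> n; rewrite mulrCA -expRD addNr expR0 mulr1.
apply/cvgrPdist_le => eps eps0.
have e3 : 0 < eps / 3 by rewrite divr_gt0.
(* J is chosen for lam alone, before n: it makes both the remainder of the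
   exponential series and the Markov bound small. *)
have [J [Je Jl]] : exists J, `|expR lam - series (exp_coeff lam) J.+1| <= eps / 3
    /\ (lam + 1) / J.+1%:R <= eps / 3.
  have /cvgrPdist_le/(_ _ e3) : series (exp_coeff lam) n.+1 @[n --> \oo] --> expR lam.
    rewrite (cvg_shiftS (series (exp_coeff lam))); exact: is_cvg_series_exp_coeff.
  have /cvgrPdist_le/(_ _ e3) : (lam + 1) / n.+1%:R @[n --> \oo] --> (lam + 1) * 0.
    by apply: cvgMl_tmp; exact: cvg_harmonic.
  rewrite mulr0 => A B.
  have [J [h1 h2]] := filter_ex (filterI A B).
  exists J; split => //; move: h1; rewrite sub0r normrN.
  by apply: le_trans; exact: ler_norm.
have sum_ratio : \sum_(j < J.+1) (q n j - exp_coeff lam j * q n 0%N)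
    @[n --> \oo] --> (0 : R).
  rewrite [X in _ --> X](_ : 0 = \sum_(j < J.+1) 0); last by rewrite big1.
  by apply: cvg_big => [|j _]; [exact: add_continuous|exact: mass_ratio_cvg].
move/cvgrPdist_le/(_ _ e3) : sum_ratio => sum_ratio.
near=> n.
have an : a n <= lam + 1.
  by near: n; move: a_cvg => /cvgr_le; apply; rewrite ltrDl.
have tail_n : 1 - \sum_(j < J.+1) q n j <= eps / 3.
  apply: (le_trans (q_tail n J)); apply: le_trans Jl.
  by rewrite ler_wpM2r// invr_ge0.
have : `|\sum_(j < J.+1) q n j - q n 0%N * series (exp_coeff lam) J.+1| <= eps / 3.
  have : `|0 - \sum_(j < J.+1) (q n j - exp_coeff lam j * q n 0%N)| <= eps / 3.
    by near: n.
  rewrite sub0r normrN sumrB -mulr_suml mulrC.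
  by rewrite /series/= big_mkord.
have : `|q n 0%N * (expR lam - series (exp_coeff lam) J.+1)| <= eps / 3.
  rewrite normrM (ger0_norm (q_ge0 _ _)) (le_trans _ Je)// ler_piMl// mass_le1//.
have := q_le1 n J.+1; rewrite !ler_norml => ?.
rewrite mulrBr; lra.
Unshelve. all: by end_near. Qed.

Lemma mass_cvg j : q n j @[n --> \oo] --> poisson_pmf lam j.
Proof.
apply: (eq_cvg_to (cvgD (mass_ratio_cvg j)
  (cvgMl_tmp (a := exp_coeff lam j) mass0_cvg))).
  by rewrite /poisson_pmf lam_gt0 add0r /exp_coeff.
by move=> n; rewrite !fctE subrK.
Qed.

End poisson_limit.

(** * Laws on the natural numbers *)

Section indicator_combination.
Context d (T : measurableType d) (R : realType) (P : probability T R).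
Variables (I : finType) (c : I -> R) (A : I -> set T).
Hypothesis mA : forall i, measurable (A i).

Let integrable_term i :
  P.-integrable [set: T] (fun t => (c i)%:E * (\1_(A i) t)%:E)%E.
Proof. by apply: integrableZl => //; exact: integrable_indic. Qed.

Lemma integrable_indicators :
  P.-integrable [set: T] (EFin \o (fun t => \sum_i c i * \1_(A i) t)).
Proof.
rewrite (_ : _ \o _ = fun t => \sum_i ((c i)%:E * (\1_(A i) t)%:E)%E).
  exact: integrable_sum.
by apply/funext => t /=; rewrite -sumEFin.
Qed.

Lemma Rintegral_indicators :
  \int[P]_t (\sum_i c i * \1_(A i) t) = \sum_i c i * fine (P (A i)).
Proof.
rewrite /Rintegral (eq_integral (fun t => \sum_i ((c i)%:E * (\1_(A i) t)%:E)%E)).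
  rewrite integral_sum//= -sum_fine => [|i _]; last first.
    exact: integrable_fin_num.
  apply: eq_bigr => i _; rewrite integralZl//; last exact: integrable_indic.
  by rewrite integral_indic// setIT fineM// fin_num_measure.
by move=> t _; rewrite -sumEFin.
Qed.

End indicator_combination.

Section laws_on_nat.
Context {R : realType}.
Implicit Types Q : probability nat R.

Lemma sum_points_cvg Q :
  \sum_(j < J) fine (Q [set (j : nat)]) @[J --> \oo] --> (1 : R).
Proof.
have h : (\sum_(0 <= i < J) Q [set i])%E @[J --> \oo] --> 1%:E.
  rewrite -(probability_setT Q) (_ : setT = \bigcup_n [set n]); last first.
    by apply/esym; rewrite -subTset => n _; exists n.
  apply: measure_semi_sigma_additive => //.
  by apply/trivIsetP => i j _ _ /eqP ij; rewrite -subset0 => x [/= -> /ij].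
apply: (eq_cvg_to (fine_cvg h)) => // J.
by rewrite /= big_mkord -sum_fine// => j _; rewrite fin_num_measure.
Qed.

(** Beyond J, a function bounded by C contributes at most C times the missing
    mass, so finitely many point masses determine its expectation up to that. *)
Lemma truncated_expectation Q (f : nat -> R) C J : (forall j, `|f j| <= C) ->
  `|\int[Q]_j f j - \sum_(j < J) f j * fine (Q [set (j : nat)])| <=
  C * (1 - \sum_(j < J) fine (Q [set (j : nat)])).
Proof.
move=> fC.
have intf (g : nat -> R) D : (forall j, `|g j| <= D) ->
    Q.-integrable [set: nat] (EFin \o g).
  move=> gD; apply: measurable_bounded_integrable => //.
    by apply: (le_lt_trans (probability_le1 _ measurableT)); rewrite ltry.
  exists D; split; [exact: num_real|move=> M DM j _].
  exact: (le_trans (gD j) (ltW DM)).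
pose g (j : nat) := \sum_(i < J) f i * \1_[set (i : nat)] j.
pose u (j : nat) := \sum_(i < J) 1 * \1_[set (i : nat)] j : R.
have indE (i j : nat) : \1_[set i] j = (j == i)%:R :> R.
  by rewrite indicE; congr (_%:R); congr nat_of_bool; apply/idP/eqP; rewrite inE.
have inu (h : nat -> R) (j : nat) : \sum_(i < J) h i * \1_[set (i : nat)] j =
    if (j < J)%N then h j else 0 :> R.
  under eq_bigr do rewrite indE.
  case: ltnP => jJ.
    rewrite (bigD1 (Ordinal jJ))//= eqxx mulr1 big1 ?addr0// => i iJ.
    by case: eqP => [ji|]; rewrite ?mulr0//; case/eqP: iJ; exact: val_inj.
  rewrite big1// => i _; rewrite gtn_eqF ?mulr0//.
  by rewrite (leq_trans (ltn_ord i)).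
have ig := integrable_indicators Q (fun i : 'I_J => f i)
  (A := fun i => [set (i : nat)]) (fun=> I).
have iu := integrable_indicators Q (fun i : 'I_J => 1)
  (A := fun i => [set (i : nat)]) (fun=> I).
have -> : \sum_(j < J) f j * fine (Q [set (j : nat)]) = \int[Q]_j g j.
  by rewrite Rintegral_indicators.
have -> : \sum_(j < J) fine (Q [set (j : nat)]) = \int[Q]_j u j.
  by rewrite Rintegral_indicators//; apply: eq_bigr => j _; rewrite mul1r.
have i1 : Q.-integrable [set: nat] (EFin \o cst 1).
  exact: finite_measure_integrable_cst.
have -> : 1 = \int[Q]_j (1 : R).
  by rewrite Rintegral_cst// mul1r; exact: (esym (congr1 fine (probability_setT Q))).
have i1u : Q.-integrable [set: nat] (EFin \o (fun j => 1 - u j)).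
  exact: (integrableB measurableT i1 iu).
have ifg : Q.-integrable [set: nat] (EFin \o (fun j => f j - g j)).
  exact: (integrableB measurableT (intf _ _ fC) ig).
rewrite -RintegralB//; last exact: intf fC.
rewrite -RintegralB// -RintegralZl//.
apply: (le_trans (le_normr_Rintegral _ ifg)) => //.
apply: le_Rintegral => //.
- exact: (integrable_norm ifg).
- exact: (integrableZl measurableT C i1u).
- move=> j _; rewrite /g /u (inu f) (inu (fun=> 1)); case: ifP => _.
    by rewrite !subrr normr0 mulr0.
  by rewrite !subr0 mulr1.
Qed.

(** A Scheffe-type statement: the limit being a probability, convergence of the
    point masses already controls the tails of the approximating laws. *)
Lemma points_cvg_weakly (Q : nat -> probability nat R) (Q0 : probability nat R)
    (f : nat -> R) C :
    (forall j, fine (Q n [set j]) @[n --> \oo] --> fine (Q0 [set j])) ->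
    (forall j, `|f j| <= C) ->
  \int[Q n]_j f j @[n --> \oo] --> \int[Q0]_j f j.
Proof.
move=> QQ0 fC; apply/cvgrPdist_le => eps eps0.
have e3 : 0 < eps / 3 by rewrite divr_gt0.
have [J Q0J] : exists J, C * (1 - \sum_(j < J) fine (Q0 [set (j : nat)])) < eps / 3.
  have h : C * (1 - \sum_(j < J) fine (Q0 [set (j : nat)])) @[J --> \oo] --> (0 : R).
    apply: (eq_cvg_to (cvgMl_tmp (a := C)
      (cvgB (cvg_cst (1 : R)) (sum_points_cvg Q0)))) => //.
    by rewrite subrr mulr0.
  by have [J ?] := filter_ex (cvgr_lt _ h _ e3); exists J.
have tail_cvg : C * (1 - \sum_(j < J) fine (Q n [set (j : nat)])) @[n --> \oo] -->
    C * (1 - \sum_(j < J) fine (Q0 [set (j : nat)])).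
  apply: cvgMl_tmp; apply: cvgB; first exact: cvg_cst.
  by apply: cvg_big => [|j _]; [exact: add_continuous|exact: QQ0].
have head_cvg : \sum_(j < J) f j * fine (Q n [set (j : nat)]) @[n --> \oo] -->
    \sum_(j < J) f j * fine (Q0 [set (j : nat)]).
  apply: cvg_big => [|j _]; [exact: add_continuous|apply: cvgMl_tmp; exact: QQ0].
move/cvgrPdist_le/(_ _ e3) : head_cvg => head_cvg.
near=> n.
have tail_n : C * (1 - \sum_(j < J) fine (Q n [set (j : nat)])) < eps / 3.
  by near: n; exact: cvgr_lt tail_cvg _ Q0J.
have head_n : `|\sum_(j < J) f j * fine (Q0 [set (j : nat)]) -
    \sum_(j < J) f j * fine (Q n [set (j : nat)])| <= eps / 3 by near: n.
have := truncated_expectation Q0 J fC; have := truncated_expectation (Q n) J fC.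
move: head_n; rewrite !ler_norml; lra.
Unshelve. all: by end_near. Qed.

End laws_on_nat.

(** * The binary vector obtained by thresholding at 1 *)

Section dichotomized_vector.
Context d (T : measurableType d) (R : realType) (P : probability T R).
Context (n : nat) (X : 'I_n -> {RV P >-> R}).

(** A Bernoulli variable is only almost surely 0 or 1.  Thresholding at 1 gives
    a vector that is binary everywhere, hence with a law on a finite set. *)
Definition ones (t : T) : {ffun 'I_n -> bool} := [ffun i => 1 <= X i t].

Definition ones_law (e : {ffun 'I_n -> bool}) : R := fine (P (ones @^-1` [set e])).

Lemma measurable_ones_fiber e : measurable (ones @^-1` [set e]).
Proof.
rewrite (_ : _ @^-1` _ =
    \bigcap_(i in [set: 'I_n]) (X i @^-1` [set x | (1 <= x) = e i])).
  apply: fin_bigcap_measurable => [|i _]; first exact: finite_finset.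
  apply: measurable_funPTI; case: (e i).
    rewrite (_ : mkset _ = `[1, +oo[%classic)//.
    by apply/seteqP; split => x /=; rewrite in_itv/= andbT.
  rewrite (_ : mkset _ = `]-oo, 1[%classic)//.
  by apply/seteqP; split => x /=; rewrite in_itv/= ltNge; [move=> ->|move/negbTE].
apply/seteqP; split => [t /= <- i _ /=|t tX /=]; first by rewrite ffunE.
by apply/ffunP => i; rewrite ffunE; exact: tX.
Qed.

Let ones_indic (h : {ffun 'I_n -> bool} -> R) :
  h \o ones = fun t => \sum_e h e * \1_(ones @^-1` [set e]) t.
Proof.
apply/funext => t /=; rewrite (bigD1 (ones t))//= indicE mem_set// mulr1.
rewrite big1 ?addr0// => e et; rewrite indicE memNset ?mulr0//= => te.
by rewrite te eqxx in et.
Qed.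

Lemma integrable_ones (h : {ffun 'I_n -> bool} -> R) :
  P.-integrable [set: T] (EFin \o (h \o ones)).
Proof.
rewrite ones_indic; apply: integrable_indicators.
exact: measurable_ones_fiber.
Qed.

Lemma Rintegral_ones (h : {ffun 'I_n -> bool} -> R) :
  \int[P]_t h (ones t) = mean ones_law h.
Proof.
rewrite -[LHS]/(\int[P]_t (h \o ones) t) ones_indic Rintegral_indicators.
  by apply: eq_bigr => e _; rewrite mulrC.
exact: measurable_ones_fiber.
Qed.

Lemma expectation_ones (h : {ffun 'I_n -> bool} -> R) :
  'E_P[h \o ones]%E = (mean ones_law h)%:E.
Proof.
rewrite -Rintegral_ones unlock fineK//.
by apply: integrable_fin_num => //; exact: integrable_ones.
Qed.

Lemma covariance_ones (h g : {ffun 'I_n -> bool} -> R) :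
  covariance P (h \o ones) (g \o ones) = (cov ones_law h g)%:E.
Proof.
rewrite covarianceE.
  rewrite -[(_ * _)%R]/((fun e => h e * g e) \o ones).
  by rewrite !expectation_ones.
all: apply/Lfun1_integrable; try exact: integrable_ones.
exact: (integrable_ones (fun e => h e * g e)).
Qed.

Lemma ones_law_ge0 e : 0 <= ones_law e.
Proof. exact: fine_ge0. Qed.

Lemma sum_ones_law : \sum_e ones_law e = 1.
Proof.
transitivity (mean ones_law (fun=> 1)).
  by apply: eq_bigr => e _; rewrite mulr1.
by rewrite -Rintegral_ones Rintegral_cst// mul1r (congr1 fine (probability_setT P)).
Qed.

(** Thresholding each coordinate is a nondecreasing operation, so it preserves
    association. *)
Lemma ones_associated : associated P X -> cube_associated ones_law.
Proof.
move=> assoc_X h g mh mg; rewrite -lee_fin -covariance_ones.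
pose up (x : 'I_n -> R) : {ffun 'I_n -> bool} := [ffun i => 1 <= x i].
have up_mono (f : {ffun 'I_n -> bool} -> R) :
    cube_nondecreasing f -> coord_nondecreasing (f \o up).
  move=> mf x y xy; apply: mf => i; rewrite !ffunE.
  by case: (leP 1 (x i)) => // x1; rewrite (le_trans x1).
apply: (assoc_X (h \o up) (g \o up)); rewrite ?up_mono//.
all: try exact: up_mono.
all: apply/Lfun1_integrable.
- exact: (integrable_ones h).
- exact: (integrable_ones g).
- exact: (integrable_ones (fun e => h e * g e)).
Qed.

Definition number_of_ones (t : T) : nat := hits (ones t).

Lemma measurable_hits : measurable_fun [set: T] number_of_ones.
Proof.
move=> _ U _; rewrite setTI (_ : _ @^-1` _ =
    \bigcup_(e in [set e | U (hits e)]) (ones @^-1` [set e])).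
  apply: fin_bigcup_measurable => [|e _]; first exact: finite_finset.
  exact: measurable_ones_fiber.
apply/seteqP; split => [t /= Ut|t [e /= Ue te]]; last by rewrite /number_of_ones te.
by exists (ones t).
Qed.

HB.instance Definition _ := isMeasurableFun.Build _ _ _ _ number_of_ones measurable_hits.

Definition ones_count : {RV P >-> nat} := number_of_ones.

Lemma ones_count_point j :
  fine (distribution P ones_count [set j]) =
  mean ones_law (fun e => (hits e == j)%:R).
Proof.
rewrite -Rintegral_ones /Rintegral.
rewrite (eq_integral (fun t => (\1_(ones_count @^-1` [set j]) t)%:E)).
  rewrite integral_indic ?setIT// -[X in measurable X]setTI.
  exact: measurable_hits.
by move=> t _; rewrite indicE; congr ((_%:R)%:E); congr nat_of_bool;
  apply/eqP/idP; rewrite inE.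
Qed.

End dichotomized_vector.

Section bernoulli_variables.
Context d (T : measurableType d) (R : realType) (P : probability T R).
Implicit Types X Y : {RV P >-> R}.

(** The values 1 and 0 already carry the masses p and 1 - p. *)
Lemma bernoulli_ae X p : has_bernoulli_law P X p ->
  {ae P, forall t, X t = (1 <= X t)%R%:R}.
Proof.
move=> [X1 X0].
have m1 : measurable (X @^-1` [set 1]) by exact: measurable_funPTI.
have m0 : measurable (X @^-1` [set 0]) by exact: measurable_funPTI.
exists (~` (X @^-1` [set 1] `|` X @^-1` [set 0])); split.
- by apply: measurableC; exact: measurableU.
- rewrite probability_setC; last exact: measurableU.
  have -> : P (X @^-1` [set 1] `|` X @^-1` [set 0]) = (p%:E + (1 - p)%:E)%E.
    rewrite -X1 -X0; apply: measureU => //.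
    by rewrite -subset0 => t [/= -> /eqP]; rewrite oner_eq0.
  by rewrite -!EFinD subrKC subrr.
- move=> t /= tX [] tX'; apply: tX; rewrite tX'; first by rewrite lexx.
  by rewrite ler10.
Qed.

Lemma bernoulli_ge1 X p : has_bernoulli_law P X p ->
  P [set t | 1 <= X t] = p%:E.
Proof.
move=> [X1 X0].
have m1 : measurable (X @^-1` [set 1]) by exact: measurable_funPTI.
have m0 : measurable (X @^-1` [set 0]) by exact: measurable_funPTI.
have m1oo : measurable [set t | 1 <= X t].
  rewrite (_ : mkset _ = X @^-1` `[1, +oo[%classic); first exact: measurable_funPTI.
  by apply/seteqP; split => t /=; rewrite in_itv/= andbT.
apply/eqP; rewrite eq_le; apply/andP; split; last first.
  rewrite -X1; apply: (le_measure P); rewrite ?inE//.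
  by move=> t /= ->.
have : (P (([set t | 1 <= X t] `|` X @^-1` [set 0])%R) <= 1)%E.
  by apply: probability_le1; exact: measurableU.
have -> : P ([set t | 1 <= X t] `|` X @^-1` [set 0]) =
    (P [set t | (1 <= X t)%R] + (1 - p)%:E)%E.
  rewrite -X0; apply: measureU => //.
  by rewrite -subset0 => t [/= + tX]; rewrite tX ler10.
by rewrite -(fineK (fin_num_measure P _ m1oo)) -EFinD !lee_fin; lra.
Qed.

Lemma ae_eq_expectation (f g : T -> R) :
    measurable_fun [set: T] f -> measurable_fun [set: T] g ->
    {ae P, forall t, f t = g t} ->
  'E_P[f]%E = 'E_P[g]%E.
Proof.
move=> mf mg fg; rewrite unlock; apply: ae_eq_integral => //.
- exact/measurable_EFinP.
- exact/measurable_EFinP.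
- by apply: filterS fg => t -> _.
Qed.

Lemma ae_eq_covariance (f f' g g' : T -> R) :
    measurable_fun [set: T] f -> measurable_fun [set: T] f' ->
    measurable_fun [set: T] g -> measurable_fun [set: T] g' ->
    {ae P, forall t, f t = f' t} -> {ae P, forall t, g t = g' t} ->
  covariance P f g = covariance P f' g'.
Proof.
move=> mf mf' mg mg' ff' gg'; rewrite unlock.
rewrite (ae_eq_expectation mf mf' ff') (ae_eq_expectation mg mg' gg').
apply: ae_eq_expectation.
- by apply: measurable_funM; exact: measurable_funB.
- by apply: measurable_funM; exact: measurable_funB.
- by apply: filterS2 ff' gg' => t /= ft gt; rewrite !fctE /= ft gt.
Qed.

End bernoulli_variables.

Section bernoulli_vector.
Context d (T : measurableType d) (R : realType) (P : probability T R).
Context (n : nat) (X : 'I_n -> {RV P >-> R}) (p : 'I_n -> R).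
Hypothesis X_bernoulli : forall i, has_bernoulli_law P (X i) (p i).
Local Notation w := (ones_law X).

Lemma mean_hit_ones i : mean w (hit i) = p i.
Proof.
have mX : measurable [set t | 1 <= X i t].
  rewrite (_ : mkset _ = X i @^-1` `[1, +oo[%classic); first exact: measurable_funPTI.
  by apply/seteqP; split => t /=; rewrite in_itv/= andbT.
rewrite -Rintegral_ones /Rintegral.
rewrite (eq_integral (fun t => (\1_[set t | 1 <= X i t] t)%:E)).
  rewrite integral_indic// setIT.
  exact: (congr1 fine (bernoulli_ge1 (X_bernoulli i))).
move=> t _; rewrite indicE /hit ffunE; congr ((_%:R)%:E); congr nat_of_bool.
by apply/idP/idP; rewrite inE.
Qed.

Let hit_ae i : {ae P, forall t, X i t = hit i (ones X t)}.
Proof.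
by apply: filterS (bernoulli_ae (X_bernoulli i)) => t ->; rewrite /hit ffunE.
Qed.

Lemma cov_hit_ones i s :
  (cov w (hit i) (hit s))%:E = covariance P (X i) (X s).
Proof.
rewrite -covariance_ones; apply/esym; apply: ae_eq_covariance => //.
- by have /integrableP[/measurable_EFinP] := integrable_ones X (hit i).
- by have /integrableP[/measurable_EFinP] := integrable_ones X (hit s).
Qed.

Lemma sum_ae_count (S : {RV P >-> R}) : (forall t, S t = \sum_i X i t) ->
  {ae P, forall t, S t = (ones_count X t)%:R}.
Proof.
move=> SE.
have : {ae P, forall t, forall i, X i t = hit i (ones X t)}.
  by apply: filter_forall => i; exact: hit_ae.
apply: filterS => t Xt; rewrite SE /ones_count natr_hits.
by apply: eq_bigr => i _.
Qed.

Lemma integral_sum_law (S : {RV P >-> R}) (f : R -> R) C :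
    (forall t, S t = \sum_i X i t) ->
    measurable_fun [set: R] f -> (forall x, `|f x| <= C) ->
  (\int[distribution P S]_x (f x)%:E)%E =
  (\int[distribution P (ones_count X)]_j f j%:R)%:E.
Proof.
move=> SE mf fC.
have int d' (T' : measurableType d') (Q : probability T' R) (g : T' -> R) :
    measurable_fun [set: T'] g ->
    Q.-integrable [set: T'] (EFin \o (f \o g)).
  move=> mg; apply: measurable_bounded_integrable => //.
  - by apply: (le_lt_trans (probability_le1 _ measurableT)); rewrite ltry.
  - exact: measurableT_comp.
  - exists C; split; [exact: num_real|move=> M CM t _].
    exact: (le_trans (fC _) (ltW CM)).
rewrite integral_distribution; last exact: int.
  rewrite /Rintegral fineK; last first.
    apply: integrable_fin_num => //.
    exact: (int _ _ (distribution P (ones_count X)) (fun j : nat => j%:R)).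
  rewrite integral_distribution//; last first.
    by apply: (int _ _ P (fun t => (ones_count X t)%:R)); exact: measurableT_comp.
  apply: ae_eq_integral => //.
  - by apply/measurable_EFinP; exact: measurableT_comp.
  - apply/measurable_EFinP/measurableT_comp => //; exact: measurableT_comp.
  - by apply: filterS (sum_ae_count SE) => t St _ /=; rewrite St.
exact/measurable_EFinP.
Qed.

End bernoulli_vector.

(** * Poisson convergence *)

(** Valid with an infinite bound M as well: the product is then infinite, unless
    K = 0, where both sides vanish. *)
Lemma sum_pairs_le (R : realType) (K : nat) (c : 'I_K -> 'I_K -> R) (M : \bar R) :
    (0 <= M)%E -> (forall i s, s != i -> ((c i s)%:E <= M)%E) ->
  ((\sum_i \sum_(s | s != i) c i s)%:E <= (K%:R ^+ 2)%:E * M)%E.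
Proof.
case: M => [x x0 cx|_ _|//].
  rewrite -EFinM lee_fin; rewrite lee_fin in x0.
  have -> : K%:R ^+ 2 * x = \sum_(i < K) \sum_(s < K) x.
    by rewrite !sumr_const !card_ord -mulrnA expr2 -natrM mulr_natl.
  apply: ler_sum => i _; rewrite [leRHS](bigID (fun s => s != i))/=.
  apply: ler_wpDr; first exact: sumr_ge0.
  by apply: ler_sum => s si; rewrite -lee_fin cx.
case: K c => [|K] c; first by rewrite big_ord0 expr0n mul0e.
by rewrite gt0_muley ?leey// lte_fin exprn_gt0.
Qed.

Lemma poisson_law_point (R : realType) (lambda : R) (j : nat) : 0 < lambda ->
  fine (poisson_prob lambda 0 [set j]) = poisson_pmf lambda j.
Proof.
by move=> l0; rewrite /poisson_prob l0 esum_set1//= lee_fin poisson_pmf_ge0.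
Qed.

Lemma integral_poisson_law (R : realType) (lambda : R) (f : R -> R) C :
    measurable_fun [set: R] f -> (forall x, `|f x| <= C) ->
  (\int[poisson_law lambda]_x (f x)%:E)%E =
  (\int[poisson_prob lambda 0]_j f j%:R)%:E.
Proof.
move=> mf fC.
have int : (poisson_prob lambda 0).-integrable [set: nat]
    (EFin \o (fun j : nat => f j%:R)).
  apply: measurable_bounded_integrable => //.
    by apply: (le_lt_trans (probability_le1 _ measurableT)); rewrite ltry.
  exists C; split; [exact: num_real|move=> M CM t _].
  exact: (le_trans (fC _) (ltW CM)).
rewrite /poisson_law integral_distribution//; last exact/measurable_EFinP.
by rewrite /Rintegral fineK//; exact: integrable_fin_num.
Qed.

Theorem theorem6 (d : measure_display) (T : measurableType d) (R : realType)
    (P : probability T R)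
    (k m l r : nat -> nat)
    (X : nat -> nat -> {RV P >-> R})
    (p : nat -> nat -> R) (lambda : R)
    (k_oo : k n @[n --> \oo] --> \oo)
    (X_assoc : forall n, (1 <= n)%N ->
       associated P (fun i : 'I_(k n) => X n i.+1))
    (k_eq : forall n, (1 <= n)%N -> k n = (m n * l n + r n)%N)
    (m_ge1 : forall n, (1 <= n)%N -> (1 <= m n)%N)
    (m_oo : m n @[n --> \oo] --> \oo)
    (r_lt_l : forall n, (1 <= n)%N -> (r n < l n)%N)
    (l_div_m : (l n)%:R / (m n)%:R @[n --> \oo] --> (0 : R))
    (X_bernoulli : forall n j, (1 <= n)%N -> (1 <= j <= k n)%N ->
       0 < p n j < 1 /\ has_bernoulli_law P (X n j) (p n j))
    (lambda_gt0 : 0 < lambda)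
    (supp_cvg0 :
       sup [set p n j | j in [set j | (1 <= j <= k n)%N]] @[n --> \oo]
         --> (0 : R))
    (sump_cvg : \sum_(1 <= j < (k n).+1) p n j @[n --> \oo] --> lambda)
    (k_supp2_cvg0 :
       (k n)%:R * sup [set p n j | j in [set j | (1 <= j <= k n)%N]] ^+ 2
         @[n --> \oo] --> (0 : R))
    (k2_supcov_cvg0 :
       (((k n)%:R ^+ 2)%:E *
        ereal_sup [set covariance P (X n ij.1) (X n ij.2) |
          ij in [set ij : nat * nat |
            [&& (1 <= ij.1 <= k n)%N, (1 <= ij.2 <= k n)%N
              & ij.1 != ij.2]]])%E @[n --> \oo] --> (0 : \bar R))
    (rest_cvg0 :
       \sum_(1 <= h < (r n).+1) p n (m n * l n + h)%N @[n --> \oo] --> (0 : R))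
    (block_cov_cvg0 :
       ((m n)%:R%:E *
        ereal_sup [set (\sum_(1 <= i < (l n).+1)
                        \sum_(1 <= s < (l n).+1 | i != s)
                          covariance P (X n (j.-1 * l n + i)%N)
                                       (X n (j.-1 * l n + s)%N))%E |
          j in [set j | (1 <= j <= m n)%N]])%E @[n --> \oo] --> (0 : \bar R))
    (rest_cov_cvg0 :
       (\sum_(1 <= i < (r n).+1) \sum_(1 <= s < (r n).+1 | i != s)
          covariance P (X n (m n * l n + i)%N) (X n (m n * l n + s)%N))%E
         @[n --> \oo] --> (0 : \bar R)) :
  weakly_converges
    (fun n => distribution P (\sum_(1 <= j < (k n).+1) X n j))
    (poisson_law lambda).
Proof.
pose Z n (i : 'I_(k n)) := X n i.+1.
pose w n := ones_law (Z n).
pose a n := \sum_i mean (w n) (hit i).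
pose q n j := mean (w n) (fun e => (hits e == j)%:R).
pose N n := distribution P (ones_count (Z n)).
pose pbar n := sup [set p n j | j in [set j | (1 <= j <= k n)%N]].
pose covsup n := ereal_sup [set covariance P (X n ij.1) (X n ij.2) |
  ij in [set ij : nat * nat | [&& (1 <= ij.1 <= k n)%N, (1 <= ij.2 <= k n)%N
    & ij.1 != ij.2]]].
have bern n (i : 'I_(k n)) : (1 <= n)%N -> 0 < p n i.+1 < 1 /\
    has_bernoulli_law P (Z n i) (p n i.+1).
  by move=> n1; exact: (X_bernoulli n i.+1 n1 (ltn_ord i)).
have assoc n : (1 <= n)%N -> cube_associated (w n).
  by move=> n1; apply: ones_associated; exact: X_assoc.
have meanE n (i : 'I_(k n)) : (1 <= n)%N -> mean (w n) (hit i) = p n i.+1.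
  move=> n1.
  apply: (mean_hit_ones (p := fun i : 'I_(k n) => p n i.+1)) => s.
  exact: (bern n s n1).2.
have covE n (i s : 'I_(k n)) : (1 <= n)%N ->
    (cov (w n) (hit i) (hit s))%:E = covariance P (X n i.+1) (X n s.+1).
  move=> n1.
  apply: (cov_hit_ones (p := fun i : 'I_(k n) => p n i.+1)) => u.
  exact: (bern n u n1).2.
have cov_ge0 n (i s : 'I_(k n)) : (1 <= n)%N -> 0 <= cov (w n) (hit i) (hit s).
  by move=> n1; apply: assoc => //; exact: hit_nondecreasing.
have a_cvg : a @ \oo --> lambda.
  move: sump_cvg; apply: cvg_trans; apply: near_eq_cvg; near=> n.
  rewrite big_add1/= big_mkord; apply: eq_bigr => i _; rewrite meanE//.
  by near: n; exact: nbhs_infty_ge.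
have sq_cvg : \sum_i mean (w n) (hit i) ^+ 2 @[n --> \oo] --> (0 : R).
  apply: (@squeeze_cvgr _ _ _ _ (fun=> 0)
    (fun n => (k n)%:R * pbar n ^+ 2)); last 2 first.
  - exact: cvg_cst.
  - exact: k_supp2_cvg0.
  near=> n; have n1 : (1 <= n)%N by near: n; exact: nbhs_infty_ge.
  apply/andP; split; first by apply: sumr_ge0 => i _; exact: sqr_ge0.
  have -> : (k n)%:R * pbar n ^+ 2 = \sum_(i < k n) pbar n ^+ 2.
    by rewrite sumr_const card_ord mulr_natl.
  apply: ler_sum => i _; rewrite meanE//.
  have [/andP[p0 _] _] := bern n i n1.
  have le_pbar : p n i.+1 <= pbar n.
    apply: ub_le_sup.
      exists 1 => _ [j /= jk <-].
      by have [/andP[_ /ltW]] := X_bernoulli n j n1 jk.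
    by exists i.+1; first exact: (ltn_ord i).
  by rewrite lerXn2r// ?nnegrE ltW// (lt_le_trans p0).
have cov_cvg : \sum_i \sum_(s | s != i) cov (w n) (hit i) (hit s)
    @[n --> \oo] --> (0 : R).
  suff h : (\sum_i \sum_(s | s != i) cov (w n) (hit i) (hit s))%:E
      @[n --> \oo] --> 0%:E.
    exact: (eq_cvg_to (fine_cvg h)).
  apply: (@squeeze_cvge _ _ _ _ (fun=> 0%E) _
    (fun n => (((k n)%:R ^+ 2)%:E * covsup n)%E)); last 2 first.
  - exact: cvg_cst.
  - exact: k2_supcov_cvg0.
  near=> n; have n1 : (1 <= n)%N by near: n; exact: nbhs_infty_ge.
  (* With a single variable there is no pair and the supremum is -oo. *)
  have k2 : (2 <= k n)%N.
    by near: n; exact: (k_oo _ (nbhs_infty_ge 2)).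
  apply/andP; split.
    by rewrite lee_fin; apply: sumr_ge0 => i _; apply: sumr_ge0 => s _; exact: cov_ge0.
  have le_covsup (i s : 'I_(k n)) : s != i ->
      ((cov (w n) (hit i) (hit s))%:E <= covsup n)%E.
    move=> si; rewrite covE//; apply: ereal_sup_ubound.
    by exists (i.+1, s.+1) => //=; rewrite !ltn_ord eqSS eq_sym.
  apply: sum_pairs_le => //.
  apply: le_trans (le_covsup (Ordinal (ltnW k2)) (Ordinal k2) _) => //.
  by rewrite lee_fin cov_ge0.
(* Both error terms of the Stein equation vanish, so q satisfies the Poisson
   recursion in the limit. *)
have stein_cvg j : a n * q n j - j.+1%:R * q n j.+1 @[n --> \oo] --> (0 : R).
  apply: norm_cvg0.
  apply: (@squeeze_cvgr _ _ _ _ (fun=> 0) (fun n =>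
    \sum_i mean (w n) (hit i) ^+ 2 +
    \sum_i \sum_(s | s != i) cov (w n) (hit i) (hit s))); last 2 first.
  - exact: cvg_cst.
  - by rewrite -[X in _ --> X](addr0 (0 : R)); exact: cvgD sq_cvg cov_cvg.
  near=> n; have n1 : (1 <= n)%N by near: n; exact: nbhs_infty_ge.
  rewrite normr_ge0; apply: stein_chen_point; last exact: assoc.
  by move=> e; exact: ones_law_ge0.
have q_cvg j : q n j @[n --> \oo] --> poisson_pmf lambda j.
  apply: (@mass_cvg R lambda a q) => //.
  - by move=> n i; apply: mean_point_ge0; exact: ones_law_ge0.
  - by move=> n J; apply: mean_points_le1; [exact: ones_law_ge0|exact: sum_ones_law].
  - by move=> n J; apply: mean_hits_tail; [exact: ones_law_ge0|exact: sum_ones_law].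
move=> f cf bf.
have mf : measurable_fun [set: R] f by exact: continuous_measurable_fun.
have [C fC] : exists C, forall x, `|f x| <= C.
  by have [M [_ hM]] := bf; exists (M + 1) => x; apply: hM => //; rewrite ltrDl.
rewrite (integral_poisson_law lambda mf fC).
have N_cvg : \int[N n]_j f j%:R @[n --> \oo] --> \int[poisson_prob lambda 0]_j f j%:R.
  apply: (@points_cvg_weakly R N _ _ C) => // j.
  rewrite poisson_law_point//; apply: (eq_cvg_to (q_cvg j)) => // n.
  by rewrite /N ones_count_point.
have {}N_cvg : (\int[N n]_j f j%:R)%:E @[n --> \oo] -->
    (\int[poisson_prob lambda 0]_j f j%:R)%:E.
  by apply: cvg_EFin => //; exact: nearW.
move: N_cvg; apply: cvg_trans; apply: near_eq_cvg; near=> n.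
have n1 : (1 <= n)%N by near: n; exact: nbhs_infty_ge.
apply/esym.
apply: (integral_sum_law (p := fun i : 'I_(k n) => p n i.+1) _ _ mf fC).
  by move=> i; exact: (bern n i n1).2.
move=> t.
rewrite (big_morph (fun Y : {RV P >-> R} => Y t) (id1 := 0) (op1 := +%R))//.
by rewrite big_add1/= big_mkord.
Unshelve. all: by end_near. Qed.
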